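(* Let $F$ be a finite field and $n$ a positive integer. (i) If $n\in\{2,3\}$, then the directed graph $\varTheta(M_n(F))\setminus\{[0],[1]\}$ contains a Hamiltonian cycle. (ii) If $n\geq 4$, then the directed graph $\varTheta(M_n(F))\setminus\{[0],[1]\}$ contains a Hamiltonian path, but the undirected graph $\overline{\varTheta}(M_n(F))\setminus\{[0],[1]\}$ does not contain a Hamiltonian cycle.
   Context: For a finite unital ring $R$, define $a\sim b$ if and only if $a=bu=vb$ for some units $u,v\in R$; this is an equivalence relation, and $[a]$ denotes the class of $a$. $\varTheta(R)$ is the directed graph whose vertices are the classes $[a]$, $a\in R$, with a directed edge $[x]\to[y]$ ($[x]$, $[y]$ not necessarily distinct) if and only if $xy=0$ (this is well defined). $\overline{\varTheta}(R)$ is the undirected graph with the same vertices, in which $[x]$ and $[y]$ (not necessarily distinct) are joined by an edge if and only if $xy=0$ or $yx=0$. Removing a set of vertices from a graph means passing to the subgraph induced on the remaining vertices. Hamiltonian paths and cycles in a directed graph are directed paths and cycles passing through every vertex exactly once. *)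

(* Defs.v *)
From HB Require Import structures.
From mathcomp Require Import all_boot all_order all_algebra.

Set Implicit Arguments.
Unset Strict Implicit.
Unset Printing Implicit Defensive.

Import GRing.Theory.
Local Open Scope ring_scope.

(* A (di)graph is a finite vertex set V in an ambient finType together with a
   relation e on that finType; only the restriction of e to V matters, so the
   induced subgraph on W \subset V is given by W and the same e. *)
Section Hamiltonian.
Variables (T : finType) (V : {set T}) (e : rel T).

Definition has_hamiltonian_path : Prop :=
  exists x p, [/\ path e x p, uniq (x :: p) & x :: p =i V].

(* For directed graphs: lengths 1 (a loop) and 2 (x -> y -> x) are allowed. *)
Definition has_hamiltonian_cycle : Prop :=
  exists s, [/\ s != [::], cycle e s, uniq s & s =i V].

(* For undirected graphs, e being symmetric: a cycle has length at least 3. *)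
Definition has_undirected_hamiltonian_cycle : Prop :=
  exists s, [/\ (2 < size s)%N, cycle e s, uniq s & s =i V].

End Hamiltonian.

Section Theta.
Variable R : finUnitRingType.
Implicit Types (a b x y : R) (A B : {set R}).

Definition uassoc : rel R := fun a b =>
  [exists u, exists v,
    [&& u \is a GRing.unit, v \is a GRing.unit, a == b * u & a == v * b]].

Definition uclass a : {set R} := [set b | uassoc a b].

Definition theta_vertices : {set {set R}} := [set uclass a | a : R].

(* See theta_edgeE: on classes this is the relation x * y = 0 between any
   representatives. *)
Definition theta_edge : rel {set R} := fun A B =>
  [exists x in A, exists y in B, x * y == 0].

Definition theta_bar_edge : rel {set R} := fun A B =>
  theta_edge A B || theta_edge B A.

Lemma uassocP a b :
  reflect (exists u v, [/\ u \is a GRing.unit, v \is a GRing.unit,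
                           a = b * u & a = v * b]) (uassoc a b).
Proof.
apply: (iffP existsP) => [[u /existsP[v /and4P[uu uv /eqP e1 /eqP e2]]]|].
  by exists u, v.
move=> [u [v [uu uv e1 e2]]]; exists u; apply/existsP; exists v.
by rewrite uu uv -e1 -e2 eqxx.
Qed.

Lemma uassoc_equiv : equivalence_rel uassoc.
Proof.
have Er : reflexive uassoc.
  by move=> a; apply/uassocP; exists 1, 1; rewrite unitr1 mulr1 mul1r.
have Es a b : uassoc a b -> uassoc b a.
  move=> /uassocP[u [v [uu uv e1 e2]]]; apply/uassocP; exists u^-1, v^-1.
  by rewrite !unitrV uu uv {1}e1 e2 mulrK // mulKr.
have Et a b c : uassoc a b -> uassoc b c -> uassoc a c.
  move=> /uassocP[u [v [uu uv e1 e2]]] /uassocP[u' [v' [uu' uv' e1' e2']]].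
  apply/uassocP; exists (u' * u), (v * v'); rewrite !unitrMl //; split=> //.
    by rewrite e1 e1' mulrA.
  by rewrite e2 e2' mulrA.
move=> a b c; split=> // ab; apply/idP/idP => [ac | bc].
  exact: Et (Es _ _ ab) ac.
exact: Et ab bc.
Qed.

Lemma uclass_eqE a b : (uclass a == uclass b) = uassoc a b.
Proof.
apply/eqP/idP => [ab | ab]; last first.
  by apply/setP => c; rewrite !inE ((uassoc_equiv a b c).2 ab).
have: b \in uclass b by rewrite inE (uassoc_equiv b b b).1.
by rewrite -ab inE.
Qed.

Lemma theta_edgeE a b : theta_edge (uclass a) (uclass b) = (a * b == 0).
Proof.
have refl x : x \in uclass x by rewrite inE (uassoc_equiv x x x).1.
apply/'exists_andP/eqP => [[x [ax /'exists_andP[y [bY /eqP xy0]]]] | ab0].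
  move: ax bY; rewrite !inE => /uassocP[u [v [uu uv e1 e2]]].
  move=> /uassocP[u' [v' [uu' uv' e1' e2']]].
  by rewrite e2 e1' mulrA -(mulrA v) xy0 mulr0 mul0r.
exists a; split; first exact: refl.
by apply/'exists_andP; exists b; rewrite refl ab0 eqxx.
Qed.

End Theta.

(* Main.v *)
(* The class of x is determined by the pair (W, U) of its left kernel and its
   row space, where dim W + dim U = n, and x y = 0 iff U_x is contained in W_y.
   Viewing (W, U) as an arc from W to U, consecutive arcs of a walk are therefore
   joined by an edge of Theta. The pairs with dimensions {t, n - t} are the arcs
   of the complete bipartite digraph between the t- and (n - t)-dimensional
   subspaces (of the complete digraph with loops if n = 2t), which has an
   Eulerian circuit based at any t-dimensional W_t. For a flag
   W_1 < W_2 < ... the circuits for t = 1, ..., n/2 can be concatenated, and for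
   n = 2, 3 there is only one of them, which is closed.
   If n >= 4, the neighbours in the undirected graph of a class of rank n - 1
   have rank 1, and there are as many classes of either rank, so a Hamiltonian
   cycle would stay within these two ranks and miss rank 2. *)

Require Import Defs.
From mathcomp Require Import all_boot all_order all_algebra.
From mathcomp Require Import zify.

Set Implicit Arguments.
Unset Strict Implicit.
Unset Printing Implicit Defensive.

Import GRing.Theory.
Local Open Scope ring_scope.

(** * Eulerian circuits in complete bipartite digraphs and in complete digraphs with loops *)

Section Circuits.
Local Open Scope nat_scope.

(** Walks are lists of arcs, so that [uniq] forbids repeated arcs only and vertices may recur. *)
Fixpoint trail (T : eqType) (x : T) (p : seq (T * T)) (y : T) : bool :=
  if p is a :: p' then (a.1 == x) && trail a.2 p' y else x == y.

Definition star (T : Type) (x : T) (s : seq T) : seq (T * T) :=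
  flatten [seq [:: (x, y); (y, x)] | y <- s].

(** [Y] is meant to be the rest of the side of [b]: each [x] of the other side makes all its round
    trips to [Y] during one excursion from [b]. *)
Definition bipartite_circuit (T : Type) (b : T) (Y X : seq T) : seq (T * T) :=
  flatten [seq (b, x) :: star x Y ++ [:: (x, b)] | x <- X].

(** Each new vertex [x] adds one detour from [b], made of the arcs between [x] and the vertices
    already treated and of the loop at [x]. *)
Fixpoint full_circuit (T : Type) (b : T) (s : seq T) : seq (T * T) :=
  if s is x :: s' then
    full_circuit b s' ++ (b, x) :: (x, x) :: star x s' ++ [:: (x, b)]
  else [:: (b, b)].

Lemma trail_cat (T : eqType) (x y z : T) p q :
  trail x p y -> trail y q z -> trail x (p ++ q) z.
Proof.
elim: p x => [|a p IHp] x /=; first by move=> /eqP->.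
by move=> /andP[-> /IHp h] /h.
Qed.

Lemma trail_star (T : eqType) (x : T) s : trail x (star x s) x.
Proof. by elim: s => //= y s; rewrite !eqxx. Qed.

Lemma size_star (T : Type) (x : T) s : size (star x s) = (size s).*2.
Proof. by elim: s => //= y s; rewrite doubleS => <-. Qed.

Lemma mem_star (T : eqType) (x y : T) s :
  y \in s -> (x, y) \in star x s /\ (y, x) \in star x s.
Proof.
move=> ys; split; apply/flatten_mapP; exists y => //;
  by rewrite !inE eqxx ?orbT.
Qed.

Lemma trail_bipartite_circuit (T : eqType) (b : T) Y X :
  trail b (bipartite_circuit b Y X) b.
Proof.
elim: X => //= x X IHX; rewrite eqxx; apply: trail_cat IHX.
by apply: trail_cat (trail_star _ _) _; rewrite /= !eqxx.
Qed.

Lemma size_bipartite_circuit (T : Type) (b : T) Y X :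
  size (bipartite_circuit b Y X) = (size X * (size Y).+1).*2.
Proof.
elim: X => //= x X IHX; rewrite !size_cat size_star IHX /= mulSn; lia.
Qed.

Lemma mem_bipartite_circuit (T : eqType) (b x y : T) Y X :
    x \in X -> y \in b :: Y ->
  (x, y) \in bipartite_circuit b Y X /\ (y, x) \in bipartite_circuit b Y X.
Proof.
move=> xX; rewrite inE => /predU1P[->|/(mem_star x)[s1 s2]];
  by split; apply/flatten_mapP; exists x => //;
     rewrite !(inE, mem_cat) ?s1 ?s2 ?eqxx ?orbT.
Qed.

Lemma trail_full_circuit (T : eqType) (b : T) s : trail b (full_circuit b s) b.
Proof.
elim: s => [|x s IHs] /=; first by rewrite !eqxx.
apply: trail_cat IHs _; rewrite /= !eqxx.
by apply: trail_cat (trail_star _ _) _; rewrite /= !eqxx.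
Qed.

Lemma size_full_circuit (T : Type) (b : T) s :
  size (full_circuit b s) = (size s).+1 * (size s).+1.
Proof.
elim: s => //= x s IHs; rewrite !(size_cat, IHs) /= !size_cat size_star /=; lia.
Qed.

Lemma mem_full_circuit (T : eqType) (b x y : T) s :
  x \in b :: s -> y \in b :: s -> (x, y) \in full_circuit b s.
Proof.
elim: s => [|z s IHs]; first by rewrite !inE => /eqP-> /eqP->.
have E w : (w \in b :: z :: s) = (w == z) || (w \in b :: s).
  by rewrite !inE orbCA.
rewrite !E /= mem_cat => /predU1P[->|xs] /predU1P[->|ys]; last by rewrite IHs.
- by rewrite !(inE, mem_cat) eqxx ?orbT.
- move: ys; rewrite inE => /predU1P[->|/(mem_star z)[s1 s2]];
  by rewrite !(inE, mem_cat) ?s1 ?s2 ?eqxx ?orbT.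
- move: xs; rewrite inE => /predU1P[->|/(mem_star z)[s1 s2]];
  by rewrite !(inE, mem_cat) ?s1 ?s2 ?eqxx ?orbT.
Qed.

Lemma eulerian_circuit (T : finType) (A B : {set T}) (b : T) :
    b \in A -> A = B \/ [disjoint A & B] ->
  exists p, [/\ trail b p b, uniq p & p =i setX A B :|: setX B A].
Proof.
move=> bA AB; set E := _ :|: _.
have sA : size (enum (A :\ b)) = #|A|.-1 by rewrite -cardE [#|A|](cardsD1 b) bA.
have A0 : 0 < #|A| by apply/card_gt0P; exists b.
have memA z : z \in A -> z \in b :: enum (A :\ b).
  by move=> zA; rewrite inE mem_enum !inE zA andbT orbN.
(* A list that contains all of [E] and is no longer than [#|E|] has no duplicates and no other
   elements, so coverage and a length bound suffice. *)
suff [p [tp szp sub]] :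
    exists p, [/\ trail b p b, size p <= #|E| & {subset E <= p}].
  have sub' : {subset enum E <= p} by move=> a; rewrite mem_enum; apply: sub.
  have szp' : size p <= size (enum E) by rewrite -cardE.
  exists p; split=> //; first exact: leq_size_uniq (enum_uniq _) sub' szp'.
  move=> a; have [_ <-] := uniq_min_size (enum_uniq _) sub' szp'.
  by rewrite mem_enum.
case: AB => [eAB | dAB].
  exists (full_circuit b (enum (A :\ b))).
  split; first exact: trail_full_circuit.
    by rewrite size_full_circuit sA /E -eAB setUid cardsX prednK.
  move=> [x y]; rewrite /E -eAB setUid inE => /andP[xA yA].
  by apply: mem_full_circuit; apply: memA.
exists (bipartite_circuit b (enum (A :\ b)) (enum B)); split.
- exact: trail_bipartite_circuit.
- rewrite size_bipartite_circuit sA prednK // -cardE cardsU !cardsX.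
  suff -> : setX A B :&: setX B A = set0 by rewrite cards0; lia.
  apply/setP => -[x y]; rewrite !inE /=; apply/negP.
  case/andP=> /andP[xA _] /andP[xB _].
  by rewrite (disjointFr dAB xA) in xB.
move=> [x y]; rewrite !inE /= => /orP[] /andP[h1 h2].
  by apply: (mem_bipartite_circuit _ _).2; rewrite ?mem_enum //; apply: memA.
by apply: (mem_bipartite_circuit _ _).1; rewrite ?mem_enum //; apply: memA.
Qed.

End Circuits.

(* Along the cycle every vertex of H is preceded and followed by a vertex of L;
   since the two sets have the same size, conversely the neighbours of every
   vertex of L lie in H. *)
Lemma cycle_confined (T : finType) (V H L : {set T}) (e : rel T) (s : seq T) :
    symmetric e -> cycle e s -> uniq s -> s =i V -> H \subset V ->
    H != set0 -> #|H| = #|L| ->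
    (forall x y, x \in H -> y \in V -> e x y -> y \in L) ->
  V \subset H :|: L.
Proof.
move=> esym cs us sV HV /set0Pn[h hH] HL nbr.
have inV x : x \in H -> x \in s by move=> xH; rewrite sV (subsetP HV).
have nL x : x \in H -> next s x \in L.
  move=> xH; apply: (nbr x) => //; first by rewrite -sV mem_next inV.
  by rewrite next_cycle ?inV.
have pL x : x \in H -> prev s x \in L.
  move=> xH; apply: (nbr x) => //; first by rewrite -sV mem_prev inV.
  by rewrite esym prev_cycle ?inV.
have pE : prev s @: H = L.
  apply/eqP; rewrite eqEcard card_imset -?HL ?leqnn; last first.
    exact: can_inj (next_prev us).
  by rewrite andbT; apply/subsetP => _ /imsetP[x xH ->]; apply: pL.
have closedHL x : x \in H :|: L -> next s x \in H :|: L.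
  rewrite inE => /orP[xH|]; first by rewrite inE nL ?orbT.
  by rewrite -{1}pE => /imsetP[y yH ->]; rewrite next_prev // inE yH.
apply/subsetP => x; rewrite -sV => xs.
(* The cycle is a single orbit of [next s], so a stable set that contains [h] contains all of it. *)
have : fconnect (next s) h x.
  by rewrite (fconnect_cycle (cycle_next us) (inV h hH)).
case/iter_findex=> <-; elim: (findex _ _ _) => [|k IHk] /=.
  by rewrite inE hH.
exact: closedHL.
Qed.

(** * Classes of matrices as pairs of a left kernel and a row space *)

Section MatrixClasses.
Variables (F : finFieldType) (n' : nat).
Local Notation n := n'.+1.
Local Notation R := ('M[F]_n'.+1 : finUnitRingType).
Local Notation arc := ('M[F]_n * 'M[F]_n)%type.
Implicit Types (a b : 'M[F]_n) (W U : 'M[F]_n) (p : arc).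

(** The left kernel of [a] is given by [copid_mx r *m invmx (col_ebase a)], so the hypothesis says
    that [pid_mx r] fixes [invmx (col_ebase a) *m b]; the invertible factors of [a] then cancel. *)
Lemma factor_of_kermx a b :
  kermx a *m b = 0 -> exists X : 'M[F]_n, b = a *m X.
Proof.
move=> kab; set r := \rank a.
have L_unit := col_ebase_unit a; have R_unit := row_ebase_unit a.
have rn : (r <= n)%N by exact: rank_leq_row.
have fix_b : pid_mx r *m (invmx (col_ebase a) *m b) = invmx (col_ebase a) *m b.
  apply/eqP; rewrite eq_sym -subr_eq0; apply/eqP.
  by rewrite -[X in X - _]mul1mx -mulmxBl mulmxA -/(copid_mx r).
exists (invmx (row_ebase a) *m pid_mx r *m (invmx (col_ebase a) *m b)).
rewrite -{1}(mulmx_ebase a) -!mulmxA mulKVmx // -/r fix_b.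
by rewrite fix_b mulKVmx.
Qed.

(** A unit factor on the left means equal row spaces, one on the right equal column spaces; the
    latter amounts to equal left kernels. *)
Lemma uassocE a b :
  @uassoc R a b = (a == b)%MS && (kermx a == kermx b)%MS.
Proof.
apply/uassocP/andP => [[u [v [uu uv e1 e2]]] | [/eqmxMunitP[v uv e2] kab]].
  split; first by apply/eqmxMunitP; exists v.
  have e3 : b = a *m invmx u by rewrite e1 mulmxK.
  apply/andP; split; apply/sub_kermxP; last by rewrite e1 mulmxA mulmx_ker mul0mx.
  by rewrite e3 mulmxA mulmx_ker mul0mx.
have fac (x y : 'M[F]_n) : (kermx x <= kermx y)%MS -> (y^T <= x^T)%MS.
  by move=> /sub_kermxP k; have [X ->] := factor_of_kermx k; rewrite trmx_mul submxMl.
have /eqmxMunitP[u uu eT] : (a^T == b^T)%MS.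
  by case/andP: kab => k1 k2; rewrite !fac.
exists u^T, v; split=> //; first by rewrite [_ \is a _]unitmx_tr.
by rewrite -[a]trmxK eT trmx_mul trmxK.
Qed.

(** Meant to have left kernel [p.1] and row space [p.2]; the kernel comes out right only if the two
    ranks add up to [n]. *)
Definition mx_of_arc p : 'M[F]_n :=
  col_ebase (cokermx p.1) *m pid_mx (\rank p.2) *m row_ebase p.2.

Lemma row_mx_of_arc p : (mx_of_arc p :=: p.2)%MS.
Proof.
rewrite -[X in (_ :=: X)%MS]mulmx_ebase /mx_of_arc -!mulmxA.
apply: eqmx_trans (eqmxMfull _ _) (eqmx_sym (eqmxMfull _ _));
  by rewrite row_full_unit col_ebase_unit.
Qed.

(** The rank condition gives [cokermx p.1] the same [pid_mx] factor as [mx_of_arc p], so the two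
    differ by an invertible right factor only. *)
Lemma ker_mx_of_arc p :
  (\rank p.1 + \rank p.2 = n)%N -> (kermx (mx_of_arc p) :=: p.1)%MS.
Proof.
move=> rn; have rC : \rank (cokermx p.1) = \rank p.2.
  by rewrite mxrank_coker; lia.
have kerE x : (x *m mx_of_arc p == 0) = (x <= p.1)%MS.
  rewrite submxE -(mulmx_ebase (cokermx p.1)) rC /mx_of_arc !mulmxA.
  have free (E : 'M[F]_n) : row_free (row_ebase E).
    by rewrite row_free_unit row_ebase_unit.
  by rewrite !(mulmx_free_eq0 _ (free _)).
apply/eqmxP/andP; split; first by rewrite -kerE mulmx_ker.
by apply/sub_kermxP/eqP; rewrite kerE.
Qed.

(** Subspaces are represented by canonical matrices, so that equal subspaces are equal elements. *)
Definition grass (t : nat) : {set 'M[F]_n} :=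
  [set A : 'M[F]_n | (<<A>>%MS == A) && (\rank A == t)].

Definition arcs : {set arc} :=
  [set p | [&& <<p.1>>%MS == p.1, <<p.2>>%MS == p.2,
     (\rank p.1 + \rank p.2 == n)%N, (0 < \rank p.1)%N & (0 < \rank p.2)%N]].

Definition arc_class p : {set R} := @uclass R (mx_of_arc p).

Definition arc_edge : rel arc := fun p q => (p.2 <= q.1)%MS.

Lemma arcsP p : reflect
  [/\ <<p.1>>%MS = p.1, <<p.2>>%MS = p.2, (\rank p.1 + \rank p.2 = n)%N,
     (0 < \rank p.1)%N & (0 < \rank p.2)%N] (p \in arcs).
Proof.
by rewrite inE; apply: (iffP and5P) => -[/eqP-> /eqP-> /eqP-> -> ->].
Qed.

Lemma theta_edge_arc p q :
  q \in arcs -> @theta_edge R (arc_class p) (arc_class q) = arc_edge p q.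
Proof.
case/arcsP=> _ _ rq _ _; rewrite theta_edgeE /arc_edge -(ker_mx_of_arc rq).
rewrite -(row_mx_of_arc p).
by apply/eqP/sub_kermxP.
Qed.

Lemma arc_class_inj : {in arcs &, injective arc_class}.
Proof.
move=> p q /arcsP[p1 p2 rp _ _] /arcsP[q1 q2 rq _ _] /eqP.
rewrite uclass_eqE uassocE => /andP[rpq kpq].
rewrite [p]surjective_pairing [q]surjective_pairing.
congr (_, _).
  rewrite -p1 -q1 -(eq_genmx (ker_mx_of_arc rp)) -(eq_genmx (ker_mx_of_arc rq)).
  exact/genmxP.
rewrite -p2 -q2 -(eq_genmx (row_mx_of_arc p)) -(eq_genmx (row_mx_of_arc q)).
exact/genmxP.
Qed.

Definition theta_proper : {set {set R}} :=
  theta_vertices R :\: [set uclass (0 : R); uclass (1 : R)].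

Lemma theta_properE : theta_proper = arc_class @: arcs.
Proof.
have ra (a : R) : (\rank a <= n)%N by exact: rank_leq_row.
apply/setP=> A; apply/setDP/imsetP => [[/imsetP[a _ ->]]|[p pV ->]].
  rewrite in_set2 negb_or !(@uclass_eqE R) => /andP[a0 a1].
  pose p := (<<kermx a>>%MS, <<a>>%MS).
  have rp : (\rank p.1 + \rank p.2 = n)%N.
    by rewrite !mxrank_gen mxrank_ker subnK.
  have pa : @uclass R a = arc_class p.
    apply/eqP; rewrite uclass_eqE uassocE; apply/andP; split; apply/eqmxP.
      exact: eqmx_trans (eqmx_sym (genmxE a)) (eqmx_sym (row_mx_of_arc p)).
    exact: eqmx_trans (eqmx_sym (genmxE _)) (eqmx_sym (ker_mx_of_arc rp)).
  exists p; last exact: pa.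
  apply/arcsP; split; [exact: genmx_id | exact: genmx_id | exact: rp | |].
    rewrite mxrank_gen mxrank_ker subn_gt0 ltn_neqAle ra andbT.
    (* A trivial left kernel would make [a] a unit, and all units lie in the class of [1]. *)
    apply: contra a1 => fa; have ua : a \in unitmx by rewrite -row_free_unit.
    by apply/uassocP; exists a, a; split; rewrite ?(mulr1 (a : R)) ?(mul1r (a : R)).
  rewrite mxrank_gen lt0n mxrank_eq0; apply: contra a0 => /eqP->.
  by rewrite (uassoc_equiv (R := R) 0 0 0).1.
case/arcsP: pV => _ _ rp p1 p2; split.
  by apply/imsetP; exists (mx_of_arc p).
rewrite /arc_class in_set2 negb_or !(@uclass_eqE R); apply/andP; split; rewrite uassocE.
  apply/negP => /andP[/eqmx_rank]; rewrite row_mx_of_arc mxrank0 => e _.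
  by rewrite e in p2.
apply/negP => /andP[/eqmx_rank]; rewrite row_mx_of_arc mxrank1 => e _.
lia.
Qed.

(** * Concatenation of the layer circuits along a flag *)

Definition flag (t : nat) : 'M[F]_n := <<pid_mx t : 'M[F]_n>>%MS.

Lemma rank_flag t : (t <= n)%N -> \rank (flag t) = t.
Proof. by move=> tn; rewrite mxrank_gen rank_pid_mx. Qed.

Lemma flag_sub s t : (s <= t)%N -> (flag s <= flag t)%MS.
Proof.
move=> st; rewrite !genmxE.
have -> : pid_mx s = pid_mx s *m (pid_mx t : 'M[F]_n) :> 'M[F]_n.
  rewrite mul_pid_mx (minn_idPl st); apply/matrixP => i j; rewrite !mxE.
  by rewrite leq_min ltn_ord.
exact: submxMl.
Qed.

Lemma flag_grass t : (t <= n)%N -> flag t \in grass t.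
Proof. by move=> tn; rewrite inE genmx_id rank_flag ?eqxx. Qed.

(** Arcs of a walk meet exactly, whereas [arc_edge] asks for inclusion only. The slack is used at
    the start, where [p] may end in a smaller space than [x]; this lets one layer follow another. *)
Lemma trail_path (x y : 'M[F]_n) s p :
  (p.2 <= x)%MS -> trail x s y -> path arc_edge p s && ((last p s).2 <= y)%MS.
Proof.
elim: s p x => [|q s IHs] p x /= px; first by move=> /eqP<-.
move=> /andP[/eqP qx ts]; rewrite {1}/arc_edge qx px /=.
exact: IHs (submx_refl _) ts.
Qed.

(** As [t <= n - t], a smaller rank [t] means ranks [t] and [n - t] in some order; the two
    Grassmannians coincide if [n = 2t] and are disjoint otherwise. *)
Lemma layer_circuit t : (0 < t)%N -> (t.*2 <= n)%N ->
  exists s, [/\ trail (flag t) s (flag t), uniq s &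
    forall p, (p \in s) = (p \in arcs) && (minn (\rank p.1) (\rank p.2) == t)].
Proof.
move=> t0 tn; have tn' : (t <= n)%N by lia.
have dG : grass t = grass (n - t) \/ [disjoint grass t & grass (n - t)].
  have [e|ne] := eqVneq t (n - t)%N; first by left; rewrite -e.
  right.
  rewrite disjoint_subset; apply/subsetP => A; rewrite !inE.
  by move=> /andP[_ /eqP->]; rewrite (negbTE ne) andbF.
have [s [ts us sE]] := eulerian_circuit (flag_grass tn') dG.
exists s; split=> // -[W U]; rewrite sE in_setU !in_setX !in_set /=.
case: (<<W>>%MS == W) => //=; case: (<<U>>%MS == U); rewrite ?andbF //=.
lia.
Qed.

Lemma layers_path m : (m.+1.*2 <= n)%N ->
  exists s, [/\ uniq s,
    forall p, (p.2 <= flag 1)%MS ->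
      path arc_edge p s && ((last p s).2 <= flag m.+1)%MS &
    forall p, (p \in s) =
      (p \in arcs) && (minn (\rank p.1) (\rank p.2) <= m.+1)%N].
Proof.
elim: m => [|m IHm] mn.
  have [s [ts us sE]] := layer_circuit (ltn0Sn 0) mn.
  exists s; split=> // p; first by move=> /trail_path; apply.
  rewrite sE; case: (boolP (p \in arcs)) => //= /arcsP[_ _ _ p1 p2]; lia.
have [|s [us ps sE]] := IHm; first by lia.
have [s' [ts us' sE']] := layer_circuit (ltn0Sn m.+1) mn.
exists (s ++ s'); split.
- rewrite cat_uniq us us' andbT; apply/hasPn => p; rewrite sE' /= sE.
  by case/andP=> -> /eqP->; rewrite -ltnNge.
(* The earlier layers end inside [flag m.+1], hence inside the base point [flag m.+2] of the next
   circuit. *)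
- move=> p /ps/andP[path_s last_s]; rewrite cat_path last_cat path_s /=.
  by apply: trail_path ts; apply: submx_trans last_s (flag_sub _).
move=> p; rewrite mem_cat sE sE' -andb_orr; congr (_ && _).
by rewrite orbC -leq_eqVlt.
Qed.

(** Two ranks with sum [n] have minimum at most [n./2], so the layers up to [n./2] exhaust the
    arcs. *)
Lemma arcs_path : (1 < n)%N ->
  exists s, [/\ uniq s, s =i arcs & forall p, (p.2 <= flag 1)%MS ->
      path arc_edge p s && ((last p s).2 <= flag n./2)%MS].
Proof.
move=> n1; have [|s [us ps sE]] := @layers_path n./2.-1; first by lia.
have n2 : n./2.-1.+1 = n./2 by lia.
exists s; split=> //; last by rewrite n2 in ps.
move=> p; rewrite sE; case: (boolP (p \in arcs)) => //= /arcsP[_ _ rp _ _]; lia.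
Qed.

Lemma path_arc_class p s : all (mem arcs) (p :: s) ->
  path arc_edge p s -> path (@theta_edge R) (arc_class p) (map arc_class s).
Proof.
move=> arcs_s; apply: homo_path_in arcs_s => x y _ yA.
by rewrite theta_edge_arc.
Qed.

Lemma map_arc_class s : uniq s -> s =i arcs ->
  uniq (map arc_class s) /\ map arc_class s =i theta_proper.
Proof.
move=> us sE; split.
  by rewrite map_inj_in_uniq // => p q; rewrite !sE; apply: arc_class_inj.
move=> A; rewrite theta_properE; apply/mapP/imsetP => -[p ps ->];
  by exists p; rewrite ?sE // -?sE.
Qed.

Lemma arcs_path_cons : (1 < n)%N ->
  exists p s, [/\ uniq (p :: s), p :: s =i arcs, (flag 1 <= p.1)%MS,
    path arc_edge p s & ((last p s).2 <= flag n./2)%MS].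
Proof.
move=> n1; have [[|p s] [us sE ps]] := arcs_path n1.
  have : (flag 1, flag n.-1) \in arcs.
    by apply/arcsP; rewrite /= !rank_flag //; split; rewrite ?genmx_id //; lia.
  by rewrite -sE.
(* The pair [(0, flag 1)] is outside [arcs]; as a virtual predecessor it forces the first arc to
   start at a space containing [flag 1]. *)
have /= := ps (0, flag 1) (submx_refl _).
by case/andP=> /andP[e1 path_s] last_s; exists p, s.
Qed.

Lemma theta_hamiltonian_path :
  (1 < n)%N -> has_hamiltonian_path theta_proper (@theta_edge R).
Proof.
move=> /arcs_path_cons[p [s [us sE _ path_s _]]].
have [us' sE'] := map_arc_class us sE.
exists (arc_class p), (map arc_class s); split=> //.
by apply: path_arc_class path_s; apply/allP => q; rewrite sE.
Qed.

Lemma theta_hamiltonian_cycle :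
  (1 < n <= 3)%N -> has_hamiltonian_cycle theta_proper (@theta_edge R).
Proof.
move=> /andP[n1 n3]; have [p [s [us sE fp path_s last_s]]] := arcs_path_cons n1.
have [us' sE'] := map_arc_class us sE.
exists (map arc_class (p :: s)); split=> //=.
(* The last arc thus ends inside [flag 1], which the start of the first arc contains, and the path
   closes up. *)
have n2 : n./2 = 1%N by lia.
rewrite -map_rcons; apply: path_arc_class.
  by apply/allP => q; rewrite -rcons_cons mem_rcons inE sE => /predU1P[->|//];
     rewrite /= -sE mem_head.
by rewrite rcons_path path_s /arc_edge (submx_trans last_s) // n2.
Qed.

(** * Absence of an undirected Hamiltonian cycle *)

Definition rank_classes (k r : nat) : {set {set R}} :=
  arc_class @: setX (grass k) (grass r).

Lemma grass_arcs k r p : (0 < k)%N -> (0 < r)%N -> (k + r = n)%N ->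
  p \in setX (grass k) (grass r) -> p \in arcs.
Proof.
case: p => W U k0 r0 kr; rewrite in_setX !in_set /=.
by move=> /andP[/andP[-> /eqP->] /andP[-> /eqP->]]; rewrite kr eqxx k0 r0.
Qed.

Lemma card_rank_classes k r : (0 < k)%N -> (0 < r)%N -> (k + r = n)%N ->
  #|rank_classes k r| = (#|grass k| * #|grass r|)%N.
Proof.
move=> k0 r0 kr; rewrite card_in_imset ?cardsX // => p q.
move=> /(grass_arcs k0 r0 kr) pA /(grass_arcs k0 r0 kr) qA.
exact: arc_class_inj.
Qed.

Lemma no_theta_bar_hamiltonian_cycle : (4 <= n)%N ->
  ~ has_undirected_hamiltonian_cycle theta_proper (@theta_bar_edge R).
Proof.
move=> n4 [s [_ cs us sE]].
have n1n : (1 + n.-1 = n)%N by lia.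
have n1n' : (n.-1 + 1 = n)%N by lia.
have n0 : (0 < n.-1)%N by lia.
have HV : rank_classes 1 n.-1 \subset theta_proper.
  rewrite theta_properE; apply: imsetS; apply/subsetP => p.
  exact: grass_arcs.
have H0 : rank_classes 1 n.-1 != set0.
  apply/set0Pn; exists (arc_class (flag 1, flag n.-1)); apply: imset_f.
  by rewrite in_setX !flag_grass //; lia.
have cardHL : #|rank_classes 1 n.-1| = #|rank_classes n.-1 1|.
  by rewrite !card_rank_classes // mulnC.
have sym : symmetric (@theta_bar_edge R).
  by move=> A B; rewrite /theta_bar_edge orbC.
have nbr A B : A \in rank_classes 1 n.-1 -> B \in theta_proper ->
    theta_bar_edge A B -> B \in rank_classes n.-1 1.
  move=> /imsetP[p pH ->]; rewrite theta_properE => /imsetP[q qA ->].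
  have pA := grass_arcs (ltn0Sn 0) n0 n1n pH.
  rewrite /theta_bar_edge !theta_edge_arc // => /orP pq.
  apply: imset_f; case: p pH {pA} pq => W U; rewrite in_setX !inE /=.
  case/andP=> /andP[_ /eqP rW] /andP[_ /eqP rU] pq.
  case/arcsP: qA => q1 q2 rq r1 r2.
  rewrite q1 q2 !eqxx /=.
  (* Either [q.1] contains the hyperplane [U] or [q.2] lies in the line [W]; as both ranks of [q]
     are positive with sum [n], each case forces them to be [n.-1] and [1]. *)
  by case: pq => /mxrankS /=; rewrite ?rW ?rU; lia.
(* A class of rank [n - 2] escapes: its kernel dimension [2] is neither [1] nor, because [n >= 4],
   equal to [n.-1]. *)
have /subsetP/(_ (arc_class (flag 2, flag (n - 2)))) :=
  cycle_confined sym cs us sE HV H0 cardHL nbr.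
have mA : (flag 2, flag (n - 2)) \in arcs.
  by apply/arcsP; rewrite /= !rank_flag; [split; rewrite ?genmx_id // | |]; lia.
rewrite {1}theta_properE imset_f // => /(_ isT).
rewrite in_setU => /orP[] /imsetP[q qH].
- have qA := grass_arcs (ltn0Sn 0) n0 n1n qH.
  move=> /arc_class_inj-/(_ mA qA) e; move: qH; rewrite -e in_setX !inE /=.
  by rewrite !rank_flag; lia.
- have qA := grass_arcs n0 (ltn0Sn 0) n1n' qH.
  move=> /arc_class_inj-/(_ mA qA) e; move: qH; rewrite -e in_setX !inE /=.
  by rewrite !rank_flag; lia.
Qed.

End MatrixClasses.

Close Scope ring_scope.

Theorem theorem3p5 (F : finFieldType) (n' : nat) :
  let n := n'.+1 in
  let R : finUnitRingType := 'M[F]_n'.+1 in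
  let V := theta_vertices R :\: [set uclass (0 : R)%R; uclass (1 : R)%R] in
  (n = 2 \/ n = 3 -> has_hamiltonian_cycle V (@theta_edge R)) /\
  (4 <= n ->
     has_hamiltonian_path V (@theta_edge R) /\
     ~ has_undirected_hamiltonian_cycle V (@theta_bar_edge R)).
Proof.
move=> n R V; split=> [n23 | n4].
  by apply: theta_hamiltonian_cycle; rewrite -/n; case: n23 => ->.
split; first by apply: theta_hamiltonian_path; exact: leq_trans n4.
exact: no_theta_bar_hamiltonian_cycle.
Qed.
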